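(* As $n\to\infty$, \[ F(n)\le n^{4/3}\exp\!\left(O\!\left(\frac{\log n}{\log\log n}\right)\right), \] where the implied constant is absolute.
   Context: For an integer $m$ and a positive integer $H$, write $I(m,H):=\{m+1,\dots,m+H\}$. For an integer $n\ge1$, $F(n)$ is the least positive integer $H$ such that, for every $m\in\mathbb Z$, the set $I(m,H)$ contains pairwise distinct integers $a_1,\dots,a_n$ satisfying $i\mid a_i$ for all $1\le i\le n$. The $O$-notation means: there is an absolute constant $C>0$ such that $F(n)\le n^{4/3}\exp(C\log n/\log\log n)$ for all sufficiently large $n$. *)

(* Defs.v *)
From HB Require Import structures.
From mathcomp Require Import all_boot all_order all_algebra.
From mathcomp Require Import all_classical all_reals all_analysis.
From mathcomp Require Import zify.

Set Implicit Arguments.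
Unset Strict Implicit.
Unset Printing Implicit Defensive.

Import Order.TTheory GRing.Theory Num.Theory.

Local Open Scope ring_scope.

Definition interval_after (m : int) (H : nat) : pred int :=
  [pred x | m + 1 <= x <= m + H%:Z].

(* Only the values of [a] at the indices 1, ..., n matter. *)
Definition admissible (n H : nat) : Prop :=
  forall m : int, exists a : nat -> int,
    {in [pred i : nat | (1 <= i <= n)%N] &, injective a} /\
    (forall i : nat, (1 <= i <= n)%N ->
       (a i \in interval_after m H) /\ (i%:Z %| a i)%Z).

(* With H = n^2 + 1, take for [a i] the largest multiple of i that is at most
   m + i n; it lies in the i-th block of length n after m. *)
Lemma admissible_exists (n : nat) :
  exists H : nat, (0 < H)%N && `[< admissible n H >].
Proof.
exists (n * n).+1; rewrite /=; apply/asboolP => m.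
exists (fun i : nat => ((m + (i * n)%:Z) %/ i%:Z)%Z * i%:Z).
have bnd (i : nat) : (1 <= i <= n)%N ->
    m + (i * n)%:Z - n%:Z < ((m + (i * n)%:Z) %/ i%:Z)%Z * i%:Z
      <= m + (i * n)%:Z.
  move=> /andP[i0 le_in].
  have := divz_eq (m + (i * n)%:Z) i%:Z.
  have := modz_ge0 (m + (i * n)%:Z) (_ : i%:Z != 0).
  have := ltz_pmod (m + (i * n)%:Z) (_ : 0 < i%:Z).
  lia.
split=> [i j|i hi]; last first.
  split; last exact: dvdz_mull.
  have := bnd i hi; rewrite inE; move/andP: hi => [i0 le_in].
  have : (i * n <= n * n)%N by rewrite leq_mul2r le_in orbT.
  have : (n <= i * n)%N by rewrite leq_pmull.
  lia.
rewrite !inE => hi hj eq_a.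
have := bnd i hi; have := bnd j hj; rewrite -eq_a.
case: (ltngtP i j) => // lt_ij.
  have : (i.+1 * n <= j * n)%N by rewrite leq_mul2r lt_ij orbT.
  rewrite mulSn; lia.
have : (j.+1 * n <= i * n)%N by rewrite leq_mul2r lt_ij orbT.
rewrite mulSn; lia.
Qed.

Definition F (n : nat) : nat := ex_minn (admissible_exists n).

(* Main.v *)
Require Import Defs.
From HB Require Import structures.
From mathcomp Require Import all_boot zify.

Set Implicit Arguments.
Unset Strict Implicit.
Unset Printing Implicit Defensive.

(** By periodicity modulo [n!] it suffices to choose, for every natural [M],
    distinct offsets [f i < H] with [i] dividing [M + f i]; by Hall's theorem this
    fails only if some [S] of size [s] has fewer than [s] offsets [o < H] such that
    [M + o] is a multiple of an element of [S].

    Let [H = 2 n D], [D = 2 ^ J * Z].  Take all [(i, k, b, z)] with [i], [k] in [S]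
    both dividing [M + b], [b < n D] and [1 <= z <= Z], and follow the offsets
    [c_j = b + 2 ^ j z k] for [0 <= j <= J].  Fix the stem [i] and let [m_j] be the
    number of such paths through [c_j] at time [j].  As [1 <= m_0] and
    [m_J <= n Z <= L ^ J], every path has a time [j < J] with
    [m_(j+1) <= L m_j].  Since [c_(j+1) = 2 c_j - b], a path through [c_j] is
    recovered from its next offset [f], which is congruent to [c_(j+1)] modulo [i],
    and from [k], a divisor of [f - c_j].  So [m_j] is at most the divisor bound [T]
    times the number of admissible offsets congruent to [c_(j+1)] modulo [i], and
    averaging over [i] in [S] shows that there are at most [J L T (T + 1) s ^ 2]
    paths.  On the other hand each [i] has [D] multiples among the [M + b], so
    Cauchy-Schwarz yields at least [s D ^ 2 Z] paths.  With
    [L], [2 ^ J] and [T] of size [n ^ (O (1 / log log n))] (for [T] by the divisor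
    bound), [D] and [Z] can be taken to be [n ^ (1/3)] times such a factor so that
    the two estimates are contradictory. *)

(** * Hall's marriage theorem *)

(* Rado's argument: in a family of sets minimal for the marriage condition all
   sets are singletons. *)
Lemma hall_marriage (T U : finType) (N : T -> {set U}) :
  (forall S : {set T}, #|S| <= #|\bigcup_(i in S) N i|) ->
  exists2 f : T -> U, injective f & forall i, f i \in N i.
Proof.
have [m] := ubnP (\sum_i #|N i|).
elim: m N => // m IH N lt_m hall.
have [/forallP small|] := boolP [forall i, #|N i| <= 1].
  have ex i : exists x, x \in N i.
    apply/set0Pn; rewrite -card_gt0.
    by have := hall [set i]; rewrite cards1 big_set1.
  exists (fun i => xchoose (ex i)); last by move=> i; apply: xchooseP.
  have Ni i x : x \in N i -> N i = [set x].
    move=> xi; apply/eqP; rewrite eq_sym eqEcard sub1set xi cards1; exact: small.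
  move=> i j eq_f; apply/eqP/negPn/negP => ne_ij.
  have := hall [set i; j].
  rewrite cards2 ne_ij bigcup_setU !big_set1.
  by rewrite (Ni _ _ (xchooseP (ex i))) (Ni _ _ (xchooseP (ex j))) eq_f setUid cards1.
rewrite negb_forall => /existsP[i]; rewrite -ltnNge => /card_gt1P[x [y [xi yi ne_xy]]].
pose Nr z k := if k == i then N i :\ z else N k.
have sum_Nr z : z \in N i -> \sum_k #|Nr z k| < m.
  move=> zi; apply: leq_trans (lt_m : _ <= m).
  rewrite (bigD1 i) //= [X in _ < X](bigD1 i) //= /Nr eqxx.
  rewrite (cardsD1 z (N i)) zi add1n addSn ltnS leq_add2l.
  by apply: leq_sum => k /negbTE ->.
(* If deleting [z] from [N i] breaks the marriage condition, a violating set must contain [i]; [S]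
   is that set without [i]. *)
have step z : z \in N i ->
    (exists2 f : T -> U, injective f & forall i, f i \in N i) \/
    exists2 S : {set T}, i \notin S &
      #|(\bigcup_(k in S) N k) :|: (N i :\ z)| <= #|S|.
  move=> zi.
  have [/forallP hz|] := boolP [forall S : {set T}, #|S| <= #|\bigcup_(k in S) Nr z k|].
    left; have [f injf fN] := IH _ (sum_Nr z zi) hz.
    exists f => // k; have := fN k; rewrite /Nr; case: eqP => // -> .
    by rewrite in_setD1 => /andP[].
  rewrite negb_forall => /existsP[S]; rewrite -ltnNge => ltS; right.
  have iS : i \in S.
    apply: contraLR ltS => iS; rewrite -leqNgt; apply: leq_trans (hall S) _.
    apply/eq_leq; congr #|pred_of_set _|; apply: eq_bigr => k kS.
    by rewrite /Nr; case: eqP kS => // ->; rewrite (negbTE iS).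
  exists (S :\ i); first by rewrite !inE eqxx.
  rewrite (cardsD1 i) iS add1n ltnS in ltS; apply: leq_trans ltS.
  rewrite (big_setD1 i iS) /= {1}/Nr eqxx setUC.
  apply/eq_leq; congr #|pred_of_set (_ :|: _)|; apply: eq_bigr => k.
  by rewrite !inE /Nr => /andP[/negbTE ->].
case: (step x xi) => // -[S iS hS].
case: (step y yi) => // -[S' iS' hS'].
exfalso.
(* Since [x] and [y] differ, [A :|: B] contains all neighbours of [i |: (S :|: S')], and [A :&: B]
   those of [S :&: S']. Adding cardinalities, [#|A| + #|B|] exceeds [#|S| + #|S'|]. *)
set A := _ :|: _ in hS; set B := _ :|: _ in hS'.
have hU := hall (i |: (S :|: S')); have hI := hall (S :&: S').
have cU : #|i |: (S :|: S')| = #|S :|: S'|.+1 by rewrite cardsU1 inE negb_or iS iS'.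
have sU : \bigcup_(k in i |: (S :|: S')) N k \subset A :|: B.
  apply/bigcupsP => k; rewrite !inE => /orP[/eqP ->|kS].
    apply/subsetP => w wi; rewrite !inE wi !andbT.
    by case: (eqVneq w x) => [->|]; rewrite ?ne_xy ?orbT.
  apply/subsetP => w wk; rewrite !inE.
  by case/orP: kS => kS; [have -> : w \in \bigcup_(k in S) N k by apply/bigcupP; exists k
    |have -> : w \in \bigcup_(k in S') N k by apply/bigcupP; exists k]; rewrite ?orbT.
have sI : \bigcup_(k in S :&: S') N k \subset A :&: B.
  apply/bigcupsP => k; rewrite inE => /andP[kS kS'].
  rewrite subsetI !(subset_trans _ (subsetUl _ _)) //; exact: bigcup_sup.
have := subset_leq_card sU; have := subset_leq_card sI.
have := cardsUI A B; have := cardsUI S S'.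
lia.
Qed.

(** * Counting tools *)

Lemma card_le_size (T : finType) (U : eqType) (A : {set T}) (g : T -> U) (s : seq U) :
  {in A &, injective g} -> (forall x, x \in A -> g x \in s) -> #|A| <= size s.
Proof.
move=> injg gs; rewrite cardE -(size_map g); apply: uniq_leq_size.
  rewrite map_inj_in_uniq ?enum_uniq // => x y.
  by rewrite !mem_enum; apply: injg.
by move=> _ /mapP[x xA ->]; apply: gs; rewrite mem_enum in xA.
Qed.

Lemma card_le_sum_fibers (T : finType) (U : eqType) (A : {set T}) (h : T -> U) (s : seq U) :
  (forall x, x \in A -> h x \in s) -> #|A| <= \sum_(y <- s) #|[set x in A | h x == y]|.
Proof.
move=> hs; rewrite -sum1_card.
under [X in _ <= X]eq_bigr => y _.
  rewrite -sum1_card (eq_bigl (fun x => (x \in A) && (h x == y))); last by move=> x; rewrite inE.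
  rewrite big_mkcondr; over.
rewrite exchange_big /=; apply: leq_sum => x xA.
by rewrite -big_mkcond sum1_count -has_count; apply/hasP; exists (h x); rewrite ?hs /=.
Qed.

Lemma nat_Cauchy_Schwarz (T : finType) (A : {set T}) (r : T -> nat) :
  (\sum_(x in A) r x) ^ 2 <= #|A| * \sum_(x in A) r x ^ 2.
Proof.
rewrite -(leq_pmul2l (isT : 0 < 2)).
have -> : 2 * (#|A| * \sum_(x in A) r x ^ 2)
   = \sum_(x in A) \sum_(y in A) (r x ^ 2 + r y ^ 2).
  under [RHS]eq_bigr => x _ do rewrite big_split sum_nat_const /=.
  by rewrite big_split /= sum_nat_const -big_distrr /= mul2n addnn.
have -> : (\sum_(x in A) r x) ^ 2 = \sum_(x in A) \sum_(y in A) r x * r y.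
  by rewrite -mulnn big_distrl; apply: eq_bigr => x _; rewrite big_distrr.
rewrite big_distrr; apply: leq_sum => x _; rewrite big_distrr; apply: leq_sum => y _.
exact: nat_Cauchy.
Qed.

Lemma card_le_fibers (T : finType) (U : eqType) (A : {set T}) (h : T -> U) (s : seq U) (m : nat) :
  (forall x, x \in A -> h x \in s) ->
  (forall y, y \in s -> #|[set x in A | h x == y]| <= m) -> #|A| <= m * size s.
Proof.
move=> hs le_m; apply: leq_trans (card_le_sum_fibers hs) _.
have -> : m * size s = \sum_(y <- s) m by rewrite big_const_seq count_predT iter_addn_0.
by rewrite big_seq [X in _ <= X]big_seq; apply: leq_sum.
Qed.

(** * Paths and an upper bound for their number *)

(* An index [i : 'I_n] stands for the integer [i.+1]; likewise [z : 'I_Z] below. *)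
Definition hits (M n : nat) (i : 'I_n) (o : nat) : bool := i.+1 %| M + o.

(** The neighbourhood of [S] in the bipartite graph of Hall's theorem. *)
Definition offsets (M n : nat) (S : {set 'I_n}) (H : nat) : seq nat :=
  [seq o <- iota 0 H | [exists i in S, hits M i o]].

(** The components [p.1.1], [p.1.2], [p.2.1], [p.2.2] carry i (the stem), k, b and z; i, k and z are
    shifted down by one. *)
Definition paths (M n B Z : nat) (S : {set 'I_n}) :
    {set 'I_n * 'I_n * ('I_B * 'I_Z)} :=
  [set p : 'I_n * 'I_n * ('I_B * 'I_Z) | [&& p.1.1 \in S, p.1.2 \in S, hits M p.1.1 p.2.1 & hits M p.1.2 p.2.1]].

Definition position (n B Z j : nat) (p : 'I_n * 'I_n * ('I_B * 'I_Z)) : nat :=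
  p.2.1 + 2 ^ j * p.2.2.+1 * p.1.2.+1.

(** Its cardinality is m_j for the stem [i] at the offset [c]. *)
Definition bundle (M n B Z : nat) (S : {set 'I_n}) (j : nat) (i : 'I_n) (c : nat) :
    {set 'I_n * 'I_n * ('I_B * 'I_Z)} :=
  [set p in paths M B Z S | (p.1.1 == i) && (position j p == c)].

Definition congruent_offsets (M n : nat) (S : {set 'I_n}) (H : nat) (i : 'I_n) (e : nat) : nat :=
  count (fun f => f == e %[mod i.+1]) (offsets M S H).

Lemma positionS (n B Z j : nat) (p : 'I_n * 'I_n * ('I_B * 'I_Z)) :
  position j.+1 p + p.2.1 = 2 * position j p.
Proof. by rewrite /position expnS -!mulnA mulnDr !mul2n -!addnn; set w := 2 ^ j * _; set b := nat_of_ord _; lia. Qed.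

Lemma bundle_self (M n B Z : nat) (S : {set 'I_n}) (j : nat) p :
  p \in paths M B Z S -> p \in bundle M B Z S j p.1.1 (position j p).
Proof. by move=> pP; rewrite inE pP !eqxx. Qed.

(** As k divides M + b, it divides M + c_j; and b < n D together with 2 ^ j z k <= n D keeps c_j
    below 2 n D. *)
Lemma position_offset (M n D J : nat) (S : {set 'I_n}) Z j p :
  2 ^ J * Z <= D -> j <= J ->
  p \in paths M (n * D) Z S -> position j p \in offsets M S (2 * n * D).
Proof.
move=> leD lej; rewrite inE => /and4P[_ kS _ hk].
rewrite mem_filter mem_iota /= add0n; apply/andP; split.
  apply/exists_inP; exists p.1.2 => //.
  by rewrite /hits /position addnA dvdn_addl // dvdn_mull.
have lt1 := ltn_ord p.2.1; have lt2 := ltn_ord p.2.2; have lt3 := ltn_ord p.1.2.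
have le1 : 2 ^ j <= 2 ^ J by rewrite leq_exp2l.
have : 2 ^ j * p.2.2.+1 * p.1.2.+1 <= D * n.
  apply: leq_mul => //; apply: leq_trans leD; exact: leq_mul.
by rewrite /position -[2 * n * D]mulnA (mul2n (n * D)) -addnn (mulnC D n) -addSn; apply: leq_add.
Qed.

(** At a fixed time, stem and offset, k and z determine b. *)
Lemma card_bundle_last (M n B Z : nat) (S : {set 'I_n}) j i c :
  #|bundle M B Z S j i c| <= n * Z.
Proof.
have -> : n * Z = #|[set: 'I_n * 'I_Z]| by rewrite cardsT card_prod !card_ord.
rewrite [X in _ <= X]cardE; apply: (card_le_size (g := fun p => (p.1.2, p.2.2))).
  move=> [[i1 k1] [b1 z1]] [[i2 k2] [b2 z2]].
  rewrite !inE /position /= => /andP[_ /andP[/eqP -> /eqP p1]] /andP[_ /andP[/eqP -> /eqP p2]].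
  case=> ek ez; subst k2 z2; do 2!f_equal; apply: val_inj => /=; lia.
by move=> p _; rewrite mem_enum inE.
Qed.

Lemma card_bundle_step (M n D J T : nat) (S : {set 'I_n}) Z j p :
  2 ^ J * Z <= D -> j < J ->
  (forall x, 0 < x < 2 * n * D -> size (divisors x) <= T) ->
  p \in paths M (n * D) Z S ->
  #|bundle M (n * D) Z S j p.1.1 (position j p)|
    <= T * congruent_offsets M S (2 * n * D) p.1.1 (position j.+1 p).
Proof.
move=> leD ltj hT pP; set i := p.1.1; set c := position j p.
rewrite /congruent_offsets -size_filter; set s := filter _ _.
(* As i divides M + b for the base b of every path with stem i, c_(j+1) = 2 c - b is congruent to M
   + 2 c modulo i: one class serves the whole bundle. *)
have hs q : q \in bundle M (n * D) Z S j i c -> position j.+1 q \in s.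
  rewrite inE => /andP[qP /andP[/eqP qi /eqP qc]].
  rewrite mem_filter (position_offset leD ltj qP) andbT.
  have h1 : position j.+1 q + q.2.1 = 2 * position j q := positionS j q.
  have h2 : position j.+1 p + p.2.1 = 2 * c := positionS j p.
  have : hits M i p.2.1 by move: pP; rewrite inE => /and4P[].
  have : hits M i q.2.1 by move: qP; rewrite inE qi => /and4P[].
  rewrite qc in h1.
  rewrite /hits => d1 d2.
  rewrite -(eqn_modDr (M + q.2.1)) addnCA h1 -(eqn_modDr (M + p.2.1)).
  rewrite (_ : position j.+1 p + _ + _ = M + 2 * c + (M + q.2.1)); last by lia.
  by rewrite eqn_modDl (eqP d1) (eqP d2).
(* Over a fixed f, f - c = 2 ^ j z k is positive. So k is one of its at most T divisors, k
   determines z, and b is fixed by f and c. *)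
apply: (card_le_fibers hs) => f; rewrite mem_filter => /andP[_ fA].
have ltf : f < 2 * n * D by move: fA; rewrite mem_filter mem_iota => /and3P[].
set fib := finset _.
have [->|[q0 q0f]] := set_0Vmem fib; first by rewrite cards0.
have gt_pos q : q \in fib -> f = c + (f - c) /\ 2 ^ j * q.2.2.+1 * q.1.2.+1 = f - c.
  rewrite !inE => /andP[/andP[_ /andP[_ /eqP qc]] /eqP qf].
  have h1 : position j.+1 q + q.2.1 = 2 * position j q := positionS j q.
  have h2 : position j q = q.2.1 + 2 ^ j * q.2.2.+1 * q.1.2.+1 by [].
  move: h1 h2; rewrite qc qf; move: (_ * _.+1) (nat_of_ord q.2.1) => w b.
  move: (c) => d; clear; lia.
have lt0 : 0 < f - c < 2 * n * D.
  have [_ ew] := gt_pos _ q0f; rewrite (leq_ltn_trans (leq_subr _ _) ltf) andbT.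
  by rewrite -ew !muln_gt0 expn_gt0.
apply: leq_trans (hT _ lt0).
apply: (card_le_size (g := fun q : 'I_n * 'I_n * ('I_(n * D) * 'I_Z) => q.1.2.+1)) => [q1 q2 q1f q2f /= eqk|q qf]; last first.
  rewrite -dvdn_divisors; last by case/andP: lt0.
  by have [_ <-] := gt_pos _ qf; rewrite dvdn_mull.
have [_ e1] := gt_pos _ q1f; have [_ e2] := gt_pos _ q2f.
move: q1f q2f e1 e2 eqk; rewrite !inE.
move=> /andP[/andP[_ /andP[/eqP q1i /eqP q1c]] _] /andP[/andP[_ /andP[/eqP q2i /eqP q2c]] _].
case: q1 q2 q1i q1c q2i q2c => [[i1 k1] [b1 z1]] [[i2 k2] [b2 z2]] /=.
rewrite /position /= => -> c1 -> c2 e1 e2 [ek].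
have -> : k1 = k2 by apply: val_inj.
have -> : b1 = b2 by apply: val_inj => /=; lia.
rewrite ek -e2 in e1.
move/eqP: e1; rewrite eqn_pmul2r // eqn_pmul2l ?expn_gt0 // => /eqP [ez].
by have -> : z1 = z2 by apply: val_inj.
Qed.

(** For distinct e and f the moduli counted are distinct divisors of |f - e|; for e = f the count is
    trivial. *)
Lemma card_moduli (n H T : nat) (S : {set 'I_n}) (e f : nat) :
  (forall x, 0 < x < H -> size (divisors x) <= T) ->
  e < H -> f < H ->
  \sum_(i in S) (f == e %[mod i.+1]) <= T + #|S| * (f == e).
Proof.
move=> hT; wlog le_ef : e f / e <= f => [hwlog eH fH | eH fH].
  case/orP: (leq_total e f) => [/hwlog-> // | /hwlog h].
  rewrite (eq_sym f); under eq_bigr do rewrite eq_sym; exact: h.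
case: (eqVneq f e) => [_|ne_fe].
  rewrite muln1 (leq_trans _ (leq_addl _ _)) // -sum1_card leq_sum // => i _.
  exact: leq_b1.
rewrite muln0 addn0.
have lt_ef : e < f by rewrite ltn_neqAle eq_sym ne_fe.
have x0 : 0 < f - e < H by rewrite subn_gt0 lt_ef (leq_ltn_trans (leq_subr _ _)).
apply: leq_trans (hT _ x0).
rewrite -big_mkcondr /= sum1_card -(cardsE (fun i => _ && _)).
apply: (card_le_size (g := fun i : 'I_n => i.+1)) => [i k _ _ [/val_inj] //|i].
rewrite inE => /andP[_]; rewrite eqn_mod_dvd // -dvdn_divisors //.
by rewrite subn_gt0.
Qed.

Lemma sum_congruent_offsets (M n H T : nat) (S : {set 'I_n}) :
  (forall x, 0 < x < H -> size (divisors x) <= T) ->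
  \sum_(i in S) \sum_(e <- offsets M S H) congruent_offsets M S H i e
    <= T * size (offsets M S H) ^ 2 + #|S| * size (offsets M S H).
Proof.
move=> hT; set A := offsets M S H.
have uA : uniq A by rewrite filter_uniq ?iota_uniq.
have ltA e : e \in A -> e < H by rewrite mem_filter mem_iota => /and3P[].
have -> : T * size A ^ 2 + #|S| * size A
    = \sum_(e <- A) \sum_(f <- A) (T + #|S| * (f == e)).
  rewrite (eq_big_seq (fun _ => T * size A + #|S|)) => [|e eA].
    by rewrite big_const_seq count_predT iter_addn_0 mulnDl -mulnA mulnn.
  rewrite big_split /= big_const_seq count_predT iter_addn_0 -big_distrr /=.
  by rewrite -big_mkcond sum1_count -/(count_mem e A) (count_uniq_mem _ uA) eA muln1.
rewrite exchange_big /= !big_seq; apply: leq_sum => e eA.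
rewrite /congruent_offsets -/A; under eq_bigr do rewrite -sum1_count big_mkcond /=.
rewrite exchange_big /= big_seq [X in _ <= X]big_seq; apply: leq_sum => f fA.
by apply: leq_trans (card_moduli S hT (ltA _ eA) (ltA _ fA)); apply: leq_sum => i _; case: eqP.
Qed.

(** Slow paths are grouped by stem and next offset. A nonempty group lies in a bundle at time j + 1;
    the slowness of one member bounds that bundle by L times one at time j, to which
    [card_bundle_step] applies. *)
Lemma card_slow_paths (M n D J T L : nat) (S : {set 'I_n}) Z j :
  2 ^ J * Z <= D -> j < J ->
  (forall x, 0 < x < 2 * n * D -> size (divisors x) <= T) ->
  #|[set p in paths M (n * D) Z S |
      #|bundle M (n * D) Z S j.+1 p.1.1 (position j.+1 p)|
        <= L * #|bundle M (n * D) Z S j p.1.1 (position j p)|]|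
    <= L * T * (T * size (offsets M S (2 * n * D)) ^ 2 + #|S| * size (offsets M S (2 * n * D))).
Proof.
move=> leD ltj hT; set G := [set p in _ | _]; set A := offsets _ _ _.
apply: leq_trans (leq_mul (leqnn _) (sum_congruent_offsets M S hT)); rewrite -/A.
pose h (p : 'I_n * 'I_n * ('I_(n * D) * 'I_Z)) := (p.1.1, position j.+1 p).
apply: (@leq_trans (\sum_(y <- [seq (i, e) | i <- enum S, e <- A]) #|[set p in G | h p == y]|)).
  apply: card_le_sum_fibers => p; rewrite inE => /andP[pP _].
  apply: allpairs_f; last exact: position_offset leD ltj pP.
  by move: pP; rewrite inE mem_enum => /andP[].
rewrite big_allpairs /= [X in X <= _]big_enum /= big_distrr; apply: leq_sum => i iS.
rewrite big_distrr; apply: leq_sum => e _.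
have [->|[p]] := set_0Vmem [set p in G | h p == (i, e)]; first by rewrite cards0.
rewrite inE => /andP[]; rewrite inE => /andP[pP pG] /eqP[ei ee].
apply: leq_trans (_ : #|bundle M (n * D) Z S j.+1 i e| <= _).
  apply/subset_leq_card/subsetP => q; rewrite !inE => /andP[/andP[-> _]].
  by rewrite /h xpair_eqE.
rewrite -ei -ee; apply: leq_trans pG _; rewrite /= -[L * T * _]mulnA; apply: leq_mul => //.
exact: card_bundle_step leD ltj hT pP.
Qed.

(** If all J steps grew by a factor above L, then m_0 >= 1 would force m_J > L ^ J >= n Z, against
    [card_bundle_last]. *)
Lemma exists_slow_step (M n B J L : nat) (S : {set 'I_n}) Z p :
  0 < J -> n * Z <= L ^ J -> p \in paths M B Z S ->
  exists2 j, j < J &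
    #|bundle M B Z S j.+1 p.1.1 (position j.+1 p)| <= L * #|bundle M B Z S j p.1.1 (position j p)|.
Proof.
move=> J0 leL pP; set m := fun j => #|bundle M B Z S j p.1.1 (position j p)|.
have [/existsP[j hj]|] := boolP [exists j : 'I_J, m j.+1 <= L * m j]; first by exists j.
rewrite negb_exists => /forallP fast.
have grow j : j < J -> L * m j < m j.+1.
  by move=> ltj; rewrite ltnNge; apply: (fast (Ordinal ltj)).
have geL j : j < J -> L ^ j <= m j.
  elim: j => [_|j IH ltj]; first by rewrite expn0 card_gt0; apply/set0Pn; exists p; apply: bundle_self.
  by rewrite expnS (leq_trans _ (ltnW (grow _ (ltnW ltj)))) // leq_mul2l IH ?orbT // ltnW.
have le1 : m J <= n * Z by apply: card_bundle_last.
case: J J0 leL grow geL le1 {fast} => // J _ leL grow geL le1.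
have := grow J (ltnSn J); have : L ^ J.+1 <= L * m J by rewrite expnS leq_mul2l geL ?orbT.
lia.
Qed.

Lemma card_paths_le (M n D J T L : nat) (S : {set 'I_n}) Z :
  0 < J -> n * Z <= L ^ J -> 2 ^ J * Z <= D ->
  (forall x, 0 < x < 2 * n * D -> size (divisors x) <= T) ->
  #|paths M (n * D) Z S| <= J * (L * T *
     (T * size (offsets M S (2 * n * D)) ^ 2 + #|S| * size (offsets M S (2 * n * D)))).
Proof.
move=> J0 leL leD hT.
pose G j := [set p in paths M (n * D) Z S |
      #|bundle M (n * D) Z S j.+1 p.1.1 (position j.+1 p)|
        <= L * #|bundle M (n * D) Z S j p.1.1 (position j p)|].
apply: (@leq_trans #|\bigcup_(j < J) G j|).
  apply/subset_leq_card/subsetP => p pP.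
  have [j ltj slow] := exists_slow_step J0 leL pP.
  by apply/bigcupP; exists (Ordinal ltj); rewrite // inE pP.
apply: (@leq_trans (\sum_(j < J) #|G j|)).
  elim/big_rec2: _ => [|j m A _ leA]; first by rewrite cards0.
  by rewrite (leq_trans (leq_card_setU _ _)) // leq_add2l.
set K := L * T * _; have -> : J * K = \sum_(j < J) K by rewrite sum_nat_const card_ord.
apply: leq_sum => j _.
exact: card_slow_paths leD (ltn_ord j) hT.
Qed.

(** * Lower bound for the number of paths, and the marriage condition *)

Definition degree (M n : nat) (S : {set 'I_n}) (b : nat) : nat := \sum_(i in S) hits M i b.

(** For fixed b the indices i and k range independently, and z is free. *)
Lemma card_paths (M n B Z : nat) (S : {set 'I_n}) :
  #|paths M B Z S| = Z * \sum_(b < B) degree M S b ^ 2.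
Proof.
rewrite -sum1_card big_distrr /=.
rewrite (eq_bigl (fun p : 'I_n * 'I_n * ('I_B * 'I_Z) =>
    ((p.1.1 \in S) && (p.1.2 \in S)) && true && (hits M p.1.1 p.2.1 && hits M p.1.2 p.2.1))); last first.
  by move=> p; rewrite inE andbT -!andbA.
rewrite big_mkcondr /=.
rewrite -(pair_big (fun q : 'I_n * 'I_n => (q.1 \in S) && (q.2 \in S)) xpredT
   (fun q w => if hits M q.1 (nat_of_ord w.1) && hits M q.2 (nat_of_ord w.1) then 1 else 0)) /=.
rewrite -(pair_big (fun i : 'I_n => i \in S) (fun k => k \in S)
  (fun i k => \sum_(w : 'I_B * 'I_Z) if hits M i (nat_of_ord w.1) && hits M k (nat_of_ord w.1) then 1 else 0)) /=.
transitivity (\sum_(i in S) \sum_(k in S) \sum_(b < B) Z * (hits M i b * hits M k b)).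
  apply: eq_bigr => i _; apply: eq_bigr => k _.
  rewrite -(pair_bigA _ (fun b z => if hits M i (nat_of_ord b) && hits M k (nat_of_ord b) then 1 else 0)) /=.
  apply: eq_bigr => b _; rewrite sum_nat_const card_ord mulnb; by case: ifP.
under eq_bigr do rewrite exchange_big /=.
rewrite exchange_big /=; apply: eq_bigr => b _.
rewrite -mulnn /degree big_distrl big_distrr /=; apply: eq_bigr => i _.
by rewrite big_distrr big_distrr.
Qed.

Lemma count_multiples (M d D n : nat) :
  0 < d <= n -> D <= \sum_(b < n * D) (d %| M + b).
Proof.
(* [r] is the least offset of a multiple of [d]; the outer reduction covers the case where [d]
   divides [M]. The hits wanted are r + t d. *)
move=> /andP[d0 ledn]; pose r := (d - M %% d) %% d.
have dvd_r : d %| M + r.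
  rewrite /dvdn /r modnDmr -modnDml subnKC ?modnn //; exact/ltnW/ltn_pmod.
have ltr : r < d by rewrite ltn_pmod.
case: D => [//|D].
have pos_ub (t : 'I_D.+1) : r + t * d < n * D.+1.
  have ltt := ltn_ord t; have : t.+1 * d <= D.+1 * n by apply: leq_mul.
  rewrite mulSn; lia.
pose g t := Ordinal (pos_ub t).
have injg : injective g.
  move=> t u /(congr1 val) /= /eqP; rewrite eqn_add2l eqn_pmul2r // => /eqP; exact: val_inj.
rewrite -[X in X <= _]card_ord -(card_image injg).
rewrite -sum1_card big_mkcond /=; apply: leq_sum => b _.
case: ifP => // /imageP[t _ ->] /=.
by rewrite addnA dvdn_addl ?dvd_r ?dvdn_mull.
Qed.

Lemma marriage_condition (M n D J T L : nat) (S : {set 'I_n}) Z :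
  0 < J -> n * Z <= L ^ J -> 2 ^ J * Z <= D -> 
  (forall x, 0 < x < 2 * n * D -> size (divisors x) <= T) ->
  L * J * (T * T.+1) * n < D ^ 2 * Z ->
  #|S| <= size (offsets M S (2 * n * D)).
Proof.
move=> J0 leL leD hT big; rewrite leqNgt; apply/negP => lt_aS.
set a := size _ in lt_aS *.
have := card_paths_le M S J0 leL leD hT; rewrite -/a card_paths; set Q := \sum_(b < _) _ => leQ.
(* The degree vanishes off [A], and [A] injects into the offsets, so Cauchy-Schwarz over [A] costs
   only a factor [a]. *)
pose A := [set b : 'I_(n * D) | 0 < degree M S b].
have leA : #|A| <= a.
  rewrite /a; apply: (card_le_size (g := fun b : 'I_(n * D) => nat_of_ord b)) => [b b' _ _ /val_inj //|b].
  rewrite inE mem_filter mem_iota /= add0n lt0n sum_nat_eq0 negb_forall => /existsP[i].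
  rewrite negb_imply => /andP[iS]; rewrite eqb0 negbK => hi.
  rewrite -mulnA (leq_trans (ltn_ord b)) ?leq_pmull // andbT.
  by apply/existsP; exists i; rewrite iS.
have lower : #|S| * D <= \sum_(b in A) degree M S b.
  have -> : \sum_(b in A) degree M S b = \sum_(b < n * D) degree M S b.
    rewrite big_mkcond /=; apply: eq_bigr => b _; rewrite inE lt0n.
    by case: eqP => // ->.
  rewrite exchange_big /= -sum_nat_const; apply: leq_sum => i _.
  by apply: count_multiples; rewrite /= ltn_ord.
have leQA : \sum_(b in A) degree M S b ^ 2 <= Q.
  by rewrite big_mkcond /=; apply: leq_sum => b _; case: ifP.
have CS := nat_Cauchy_Schwarz A (fun b => degree M S b).
have s0 : 0 < #|S| by apply: leq_ltn_trans lt_aS.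
set s := #|S| in lt_aS leQ lower s0 *.
have leSn : s <= n by rewrite -[n in _ <= n]card_ord; apply: max_card.
(* Cauchy-Schwarz gives (s D) ^ 2 <= a Q, and Z Q, the number of paths, is bounded above; each [a]
   is then replaced by [s]. Cancelling s ^ 2 and using s <= n contradicts [big]. *)
have main : (s * D) ^ 2 * Z <= s * (J * (L * T * (T * s ^ 2 + s * s))).
  apply: (@leq_trans (a * Q * Z)).
    rewrite leq_mul2r; apply/orP; right; apply: leq_trans (_ : (\sum_(b in A) degree M S b) ^ 2 <= _).
      by rewrite leq_exp2r.
    apply: leq_trans CS _; exact: leq_mul.
  rewrite -mulnA; apply: leq_mul; first exact: ltnW.
  rewrite mulnC; apply: leq_trans leQ _.
  have lea := ltnW lt_aS.
  by do 2!(apply: leq_mul => //); apply: leq_add; apply: leq_mul; rewrite // leq_exp2r.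
have : s ^ 2 * (D ^ 2 * Z) <= s ^ 2 * (L * J * (T * T.+1) * s).
  move: main; rewrite expnMn; move: (D ^ 2) => DD; rewrite -!mulnn; nia.
rewrite leq_pmul2l ?expn_gt0 ?s0 // => le1.
move: big; rewrite ltnNge (leq_trans le1) //; exact: leq_mul.
Qed.

Lemma hall_offsets (M n D J T L Z : nat) :
  0 < J -> n * Z <= L ^ J -> 2 ^ J * Z <= D -> 
  (forall x, 0 < x < 2 * n * D -> size (divisors x) <= T) ->
  L * J * (T * T.+1) * n < D ^ 2 * Z ->
  exists2 f : 'I_n -> 'I_(2 * n * D), injective f & forall i : 'I_n, i.+1 %| M + f i.
Proof.
move=> J0 leL leD hT big.
have [S|f injf hf] := @hall_marriage 'I_n 'I_(2 * n * D) (fun i => [set o | hits M i (nat_of_ord o)]).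
  apply: leq_trans (marriage_condition M S J0 leL leD hT big) _.
  set A := offsets _ _ _; set N := \bigcup_(i in S) _.
  rewrite [X in _ <= X]cardE -(size_map val); apply: uniq_leq_size.
    by rewrite filter_uniq ?iota_uniq.
  move=> o; rewrite mem_filter mem_iota => /andP[/exists_inP[i iS hi] /= lto].
  apply/mapP; exists (Ordinal lto) => //; rewrite mem_enum.
  by apply/bigcupP; exists i => //; rewrite inE.
by exists f => // i; have := hf i; rewrite inE.
Qed.

(** * The divisor bound *)

(** A divisor is determined by its exponent at p and its part prime to p. *)
Lemma size_divisors_pfactor (p x : nat) :
  prime p -> 0 < x -> size (divisors x) <= (logn p x).+1 * size (divisors x`_p^').
Proof.
move=> pr_p x0.
have -> : (logn p x).+1 * size (divisors x`_p^')
    = size [seq (e, d) | e <- iota 0 (logn p x).+1, d <- divisors x`_p^'].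
  by rewrite size_allpairs size_iota.
rewrite -(size_map (fun d => (logn p d, d`_p^'))); apply: uniq_leq_size.
  rewrite map_inj_in_uniq ?divisors_uniq // => d e.
  rewrite -!dvdn_divisors // => dx ex [eql eqp].
  have d0 := dvdn_gt0 x0 dx; have e0 := dvdn_gt0 x0 ex.
  by rewrite -(partnC p d0) -(partnC p e0) eqp !p_part eql.
move=> _ /mapP[d dx ->]; rewrite -dvdn_divisors // in dx.
apply: allpairs_f; first by rewrite mem_iota /= add0n ltnS dvdn_leq_log.
by rewrite -dvdn_divisors ?part_gt0 // partn_dvd.
Qed.

(** With the floor quotient, e + 1 <= q (e / q + 1) <= q 2 ^ (e / q). *)
Lemma succ_expn_le (q e : nat) : 0 < q -> e.+1 ^ q <= q ^ q * 2 ^ e.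
Proof.
move=> q0; apply: (@leq_trans ((q * 2 ^ (e %/ q)) ^ q)).
  rewrite leq_exp2r // (leq_trans (_ : _ <= q * (e %/ q).+1)) //.
    by rewrite mulnC ltn_ceil.
  by rewrite leq_mul2l ltn_expl ?orbT.
by rewrite expnMn leq_mul2l -expnM leq_pexp2l ?leq_trunc_div ?orbT.
Qed.

(** Let p have exponent e in x. If p >= 2 ^ q then (e + 1) ^ q <= 2 ^ (e q) <= p ^ e; each smaller
    prime costs a factor q ^ q by [succ_expn_le], and there are at most 2 ^ q of them. *)
Lemma size_divisors_expn (q x : nat) :
  0 < q -> 0 < x -> size (divisors x) ^ q <= q ^ (q * 2 ^ q) * x.
Proof.
move=> q0 x0; pose w p := if p < 2 ^ q then q ^ q else 1.
have prod_bound s : all prime s -> forall y, 0 < y -> {subset primes y <= s} ->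
    size (divisors y) ^ q <= (\prod_(p <- s) w p) * y.
  elim: s => [_ y y0 sub|p s IH /= /andP[pr_p pr_s] y y0 sub].
    have -> : y = 1; last by rewrite big_nil exp1n.
    apply/eqP; case: y y0 sub => [//|[//|y] _ sub].
    have : pdiv y.+2 \in primes y.+2 by rewrite mem_primes pdiv_prime //= pdiv_dvd.
    by move/sub.
  have part0 : 0 < y`_p^' by rewrite part_gt0.
  have {}IH : size (divisors y`_p^') ^ q <= (\prod_(r <- s) w r) * y`_p^'.
    apply: IH => // r; rewrite primes_part mem_filter => /andP[r_p /sub].
    by rewrite inE; case/orP => // /eqP er; rewrite er !inE eqxx in r_p.
  apply: leq_trans (_ : ((logn p y).+1 * size (divisors y`_p^')) ^ q <= _).
    by rewrite leq_exp2r // size_divisors_pfactor.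
  rewrite big_cons -[X in _ <= _ * X](partnC p y0) p_part expnMn.
  rewrite -mulnA [X in _ <= _ * X]mulnCA mulnA; apply: leq_mul => //.
  have p2 := prime_gt1 pr_p.
  rewrite /w; case: ltnP => [_|le_p].
    apply: leq_trans (succ_expn_le _ q0) _; rewrite leq_mul2l; apply/orP; right.
    by case: (logn p y) => // e; rewrite leq_exp2r.
  rewrite mul1n; apply: leq_trans (_ : (2 ^ logn p y) ^ q <= _).
    by rewrite leq_exp2r // ltn_expl.
  by rewrite -expnM mulnC expnM; case: (logn p y) => // e; rewrite leq_exp2r.
have := prod_bound (primes x) (all_prime_primes x) x x0 (fun p h => h).
move=> /leq_trans; apply; rewrite leq_mul2r; apply/orP; right.
rewrite -big_mkcond /= big_const_seq iter_muln_1 expnM leq_pexp2l ?expn_gt0 ?q0 //.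
rewrite -size_filter -[X in _ <= X](size_iota 0); apply: uniq_leq_size.
  by rewrite filter_uniq ?primes_uniq.
by move=> p; rewrite mem_filter mem_iota /= => /andP[].
Qed.

Lemma size_divisors_pow2 (q m x : nat) :
  0 < q -> 0 < x < 2 ^ m -> size (divisors x) <= 2 ^ (q * 2 ^ q + (m %/ q).+1).
Proof.
move=> q0 /andP[x0 ltx]; rewrite -(leq_exp2r _ _ q0).
apply: leq_trans (size_divisors_expn q0 x0) _.
rewrite -expnM mulnDl expnD; apply: leq_mul.
  by rewrite [X in _ <= 2 ^ X]mulnC [2 ^ (q * (_ * _))]expnM leq_exp2r ?muln_gt0 ?q0 ?expn_gt0 // ltnW // ltn_expl.
by apply: leq_trans (ltnW ltx) _; rewrite leq_pexp2l // ltnW ?ltn_ceil.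
Qed.

(** * Choice of the parameters *)

Lemma sqrn_le_exp2 (q : nat) : q ^ 2 <= 2 ^ q.+1.
Proof.
elim: q => [//|q IH].
case: (ltnP q 3) => [|le3q]; first by case: q IH => [|[|[|]]].
rewrite expnS; apply: leq_trans (_ : 2 * q ^ 2 <= _); last by rewrite leq_mul2l IH.
by rewrite -!mulnn; nia.
Qed.

Lemma hall_offsets_explicit (n l q : nat) :
  2 ^ l <= n < 2 ^ l.+1 -> 21 <= q -> 4 ^ q <= l ->
  exists2 E, q * E <= 21 * l &
    forall M, exists2 f : 'I_n -> 'I_(n * 2 ^ (l %/ 3 + E).+1),
      injective f & forall i : 'I_n, i.+1 %| M + f i.
Proof.
move=> /andP[_ ltn] q21 le4q.
have q0 : 0 < q by apply: leq_trans q21.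
(* The choices are L = 2 ^ q, T = 2 ^ t, Z = 2 ^ (k + y) and D = 2 ^ J Z. [J] gives L ^ J >= n Z,
   [t] is the exponent of [size_divisors_pow2] below 2 ^ (4 l), 2 ^ (3 k) exceeds n, and 2 ^ (3 y)
   absorbs L J T (T + 1). *)
pose J := ((4 * l) %/ q).+1; pose t := q * 2 ^ q + J.
pose y := q + J + t.+1; pose k := (l %/ 3).+1.
have lt_qq : q < 2 ^ q by rewrite ltn_expl.
have e4 : 4 ^ q = 2 ^ q * 2 ^ q by rewrite -expnMn.
have sq := sqrn_le_exp2 q.
have qJ1 : 4 * l <= q * J by rewrite /J [q * _]mulnC ltnW // ltn_ceil.
have qJ2 : q * J <= 4 * l + q by rewrite /J mulnS addnC leq_add2r [q * _]mulnC leq_trunc_div.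
have qE : q * (1 + J + y) <= 21 * l.
  have h : q * q * 2 ^ q <= 2 * l.
    apply: leq_trans (_ : 2 ^ q.+1 * 2 ^ q <= _); first by rewrite leq_mul2r mulnn sq orbT.
    by rewrite expnS -mulnA -e4 leq_mul2l.
  have h2 : q * q <= l by apply: leq_trans le4q; rewrite e4; apply: leq_mul; exact: ltnW.
  have h3 : q <= l by apply: leq_trans h2; rewrite leq_pmull.
  rewrite /y /t; move: (J) (2 ^ q) qJ2 h h2 h3 => j w; clear; lia.
(* Here q >= 21 enters; the bound keeps n Z and 2 n D at most 2 ^ (4 l). *)
have Esmall : 1 + J + y <= l.
  by rewrite -(leq_pmul2l q0) (leq_trans qE) // leq_mul2r q21 orbT.
exists (1 + J + y) => // M.
have -> : n * 2 ^ (l %/ 3 + (1 + J + y)).+1 = 2 * n * (2 ^ J * 2 ^ (k + y)).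
  rewrite -expnD mulnAC -expnS mulnC; congr (2 ^ _ * _); rewrite /k; lia.
apply: (@hall_offsets M n _ J (2 ^ t) (2 ^ q) (2 ^ (k + y))) => //.
- rewrite -expnM; apply: leq_trans (_ : 2 ^ (l.+1 + (k + y)) <= _).
    by rewrite [2 ^ (l.+1 + _)]expnD leq_mul2r ltnW ?orbT.
  rewrite leq_exp2l // (leq_trans _ qJ1) // /k; lia.
- move=> x /andP[x0 ltx]; apply: (@size_divisors_pow2 q (4 * l)) => //; rewrite x0.
  apply: leq_trans ltx _; rewrite mulnAC -expnD -expnS.
  apply: leq_trans (leq_mul (leqnn _) (ltnW ltn)) _.
  rewrite -expnD leq_exp2l // /k; lia.
clearbody t.
apply: (@leq_trans (2 ^ (q + J + t + t.+1) * 2 ^ (3 * k))).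
  apply: leq_ltn_trans (_ : _ <= 2 ^ (q + J + t + t.+1) * n) _; last first.
    rewrite ltn_pmul2l ?expn_gt0 // (leq_trans ltn) // leq_exp2l // /k; lia.
  rewrite leq_mul2r !expnD -!mulnA; apply/orP; right.
  have ltJ : J <= 2 ^ J by rewrite ltnW // ltn_expl.
  have ltT : (2 ^ t).+1 <= 2 ^ t.+1 by rewrite expnS mul2n -addnn -addn1 leq_add2l expn_gt0.
by do 2!(apply: leq_mul => //); apply: leq_mul.
rewrite -(expnD _ J) -expnM -!expnD leq_exp2l // /y; lia.
Qed.

(* Return to integers, and the asymptotic bound *)
From mathcomp Require Import all_order all_algebra.
From mathcomp Require Import all_classical all_reals all_analysis.
From mathcomp Require Import lra.

Import Order.TTheory GRing.Theory Num.Theory.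
Local Open Scope classical_set_scope.
Local Open Scope ring_scope.

(** Divisibility by i <= n depends only on residues modulo n!, so [m + 1], the point at offset 0,
    can be replaced by a congruent natural [M]. *)
Lemma admissible_of_nat (n H : nat) :
  (forall M : nat, exists2 f : 'I_n -> 'I_H, injective f &
     forall i : 'I_n, (i.+1 %| M + f i)%N) ->
  admissible n H.
Proof.
move=> natH m.
have [M eqM] : exists M : nat, (M%:Z == m + 1 %[mod n`!%:Z])%Z.
  exists `|((m + 1) %% n`!%:Z)%Z|%N.
  by rewrite gez0_abs ?modz_ge0 ?modz_mod // eqz_nat -lt0n fact_gt0.
have [f injf dvdf] := natH M.
(* The index i sits at the ordinal i - 1; arguments beyond n get the default 0. *)
pose a (i : nat) : int := if insub i.-1 is Some k then m + 1 + (f k : nat)%:Z else 0.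
have aE (i : nat) (hi : (1 <= i <= n)%N) :
    exists2 k : 'I_n, k.+1 = i & a i = m + 1 + (f k : nat)%:Z.
  case: i hi => // i lti; exists (Ordinal lti) => //.
  by rewrite /a /= insubT.
exists a; split=> [i j|i hi].
  move=> /aE[k <- ->] /aE[j' <- ->] /addrI eqf; congr _.+1; congr nat_of_ord.
  by apply/injf/val_inj; case: eqf.
have [k <- ->] := aE i hi; have ltf := ltn_ord (f k); split.
  by rewrite inE; lia.
have dvdn : (k.+1%:Z %| n`!%:Z)%Z by rewrite dvdzE; apply: dvdn_fact; rewrite /= ltn_ord.
have -> : m + 1 + (f k : nat)%:Z = (M + f k)%N%:Z - (M%:Z - (m + 1)) by lia.
rewrite rpredB //; first by rewrite dvdzE dvdf.
by apply: dvdz_trans dvdn _; rewrite -eqz_mod_dvd.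
Qed.

Lemma F_le (n H : nat) : (0 < H)%N -> admissible n H -> (F n <= H)%N.
Proof.
by rewrite /F => H0 adm; case: ex_minnP => N _; apply; rewrite H0; apply/asboolP.
Qed.

Lemma F_le_explicit (n l q : nat) :
  (2 ^ l <= n < 2 ^ l.+1)%N -> (21 <= q)%N -> (4 ^ q <= l)%N ->
  exists2 E, (q * E <= 21 * l)%N & (F n <= n * 2 ^ (l %/ 3 + E).+1)%N.
Proof.
move=> hn hq hl; have [E hE hall] := hall_offsets_explicit hn hq hl.
exists E => //; apply: F_le; last exact: admissible_of_nat.
have /andP[/(leq_trans _) n0 _] := hn.
by rewrite muln_gt0 n0 expn_gt0.
Qed.

Lemma natr_exp2_div3_le (R : realType) (n l : nat) :
  (2 ^ l <= n)%N -> (2 ^ (l %/ 3))%N%:R <= n%:R `^ (3^-1) :> R.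
Proof.
move=> len; set x : R := _%:R.
have -> : x = (x ^+ 3) `^ 3^-1.
  by rewrite -powR_mulrn ?ler0n // -powRrM divff ?powRr1 ?ler0n ?pnatr_eq0.
apply: ge0_ler_powR; rewrite ?nnegrE ?exprn_ge0 ?ler0n ?invr_ge0 //.
by rewrite /x -natrX ler_nat -expnM (leq_trans _ len) // leq_pexp2l // leq_trunc_div.
Qed.

Lemma natr_exp2_le_expR (R : realType) (m : nat) : (2 ^ m)%N%:R <= expR m%:R :> R.
Proof.
rewrite natrX -[m%:R]mulr1 expRM_natl lerXn2r ?nnegrE ?expR_ge0 ?ler0n //.
by apply: le_trans (expR_ge1Dx _).
Qed.

Lemma expR_half_le_exp2 (R : realType) (m : nat) : expR (m%:R / 2) <= (2 ^ m)%N%:R :> R.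
Proof.
rewrite natrX expRM_natl lerXn2r ?nnegrE ?expR_ge0 ?ler0n //.
have := expR_ge1Dx (- 2^-1 : R); rewrite expRN.
have : 0 < expR (2^-1) :> R by exact: expR_gt0.
move=> e0 h; rewrite -(ler_pV2 _ _) ?inE ?unitfE ?gt_eqF ?e0 //; lra.
Qed.

(** l is the binary logarithm of n and q the base-4 logarithm of l, so q has order log log n. *)
Lemma exists_scales (k n : nat) :
  (2 ^ 4 ^ k <= n)%N ->
  exists l q, [/\ (2 ^ l <= n < 2 ^ l.+1)%N, (k <= q)%N & (4 ^ q <= l < 4 ^ q.+1)%N].
Proof.
move=> len; pose l := trunc_log 2 n.
have lel : (4 ^ k <= l)%N by apply: trunc_log_max.
exists l, (trunc_log 4 l); split.
- by apply: trunc_log_bounds => //; apply: leq_trans len; rewrite expn_gt0.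
- exact: trunc_log_max.
by apply: trunc_log_bounds => //; apply: leq_trans lel; rewrite expn_gt0.
Qed.

Lemma scale_le_ratio (R : realType) (n l q E : nat) :
  (2 ^ l <= n < 2 ^ l.+1)%N -> (2 <= q)%N -> (4 ^ q <= l < 4 ^ q.+1)%N ->
  (q * E <= 21 * l)%N ->
  E.+1%:R <= 132 * ln n%:R / ln (ln n%:R) :> R.
Proof.
move=> /andP[len ltn] q2 /andP[leql ltlq] leE.
have leqlq : (q < l)%N by apply: leq_trans leql; apply: ltn_expl.
have n0 : 0 < n%:R :> R by rewrite ltr0n (leq_trans _ len) // expn_gt0.
set X : R := ln n%:R.
have lX : l%:R / 2 <= X.
  by rewrite -ler_expR lnK ?posrE // (le_trans (expR_half_le_exp2 R l)) // ler_nat.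
have Xl : X <= l.+1%:R.
  rewrite -ler_expR lnK ?posrE // (le_trans _ (natr_exp2_le_expR R _)) //.
  by rewrite ler_nat ltnW.
have X1 : 1 < X.
  apply: lt_le_trans lX; rewrite ltr_pdivlMr // mul1r (ltr_nat R 2).
  exact: leq_ltn_trans leqlq.
have X0 : 0 < X by apply: lt_trans X1.
have lnX0 : 0 < ln X by rewrite ln_gt0.
(* X <= l + 1 <= 4 ^ (q + 1) <= exp (2 (q + 1)), and 2 (q + 1) <= 3 q because q >= 2. *)
have lnX : ln X <= (q * 3)%:R.
  apply: (@le_trans _ _ (2 * q.+1)%:R); last by rewrite ler_nat; lia.
  rewrite -ler_expR lnK ?posrE // (le_trans _ (natr_exp2_le_expR R _)) //.
  by apply: le_trans Xl _; rewrite ler_nat expnM.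
rewrite ler_pdivlMr //.
have h1 : E.+1%:R * ln X <= (E.+1 * (q * 3))%:R.
  by rewrite natrM; apply: ler_wpM2l.
(* From q E <= 21 l and q < l, 3 q (E + 1) <= 63 l + 3 l; then l <= 2 X gives 132. *)
apply: le_trans h1 _; apply: (@le_trans _ _ (66 * l)%:R).
  by rewrite ler_nat; nia.
by rewrite natrM; lra.
Qed.

Theorem theorem1p1 (R : realType) :
  exists2 C : R, 0 < C &
    \forall n \near \oo,
      (F n)%:R <= n%:R `^ (4 / 3) * expR (C * ln n%:R / ln (ln n%:R)).
Proof.
exists 132 => //.
have [N Nbig] : exists N, forall n, (N <= n)%N ->
    exists l q, [/\ (2 ^ l <= n < 2 ^ l.+1)%N, (21 <= q)%N & (4 ^ q <= l < 4 ^ q.+1)%N].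
  (* This threshold forces q >= 21. *)
  by exists (2 ^ 4 ^ 21)%N; apply: exists_scales.
near=> n.
have [|l [q [hn q21 hl]]] := Nbig n; first by near: n; apply: nbhs_infty_ge.
have /andP[leql _] := hl; have /andP[len _] := hn.
have [E qE leF] := F_le_explicit hn q21 leql.
have n0 : (0 < n)%N by rewrite (leq_trans _ len) // expn_gt0.
(* 2 ^ (l / 3) is at most the cube root of n, and the remaining 2 ^ (E + 1) is at most exp (E +
   1). *)
apply: (@le_trans _ _ (n%:R * n%:R `^ 3^-1 * expR E.+1%:R)).
  rewrite -(ler_nat R) in leF; apply: le_trans leF _.
  rewrite -addnS expnD mulnA !natrM; apply: ler_pM => //.
    by apply: ler_wpM2l => //; exact: natr_exp2_div3_le.
  exact: natr_exp2_le_expR.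
have -> : n%:R `^ (4 / 3) = n%:R * n%:R `^ 3^-1 :> R.
  have -> : 4 / 3 = 1 + 3^-1 :> R by lra.
  by rewrite powRD ?powRr1 // pnatr_eq0 -lt0n n0 implybT.
apply: ler_wpM2l; first by rewrite mulr_ge0 ?powR_ge0.
by rewrite ler_expR (scale_le_ratio R hn _ hl qE) // (leq_trans _ q21).
Unshelve. all: by end_near.
Qed.
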